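(* Let $n\ge2$, let $T$ be a strict t-norm, let $p,q>0$, and let $\alpha_i=\langle\mu_{\alpha_i},\eta_{\alpha_i},\nu_{\alpha_i}\rangle$ ($i=1,\dots,n$) be picture fuzzy numbers. Then $$\big\langle\min_i\mu_{\alpha_i},\ \min_i\eta_{\alpha_i},\ \max_i\nu_{\alpha_i}\big\rangle\preccurlyeq_{\mathrm W}\mathrm{PFIBM}_T^{p,q}(\alpha_1,\dots,\alpha_n)\preccurlyeq_{\mathrm W}\big\langle\max_i\mu_{\alpha_i},\ 1-(\max_i\mu_{\alpha_i}+\min_i\nu_{\alpha_i}),\ \min_i\nu_{\alpha_i}\big\rangle.$$
   Context: A picture fuzzy number (PFN) is a triple $\alpha=\langle\mu,\eta,\nu\rangle$ with $\mu,\eta,\nu\in[0,1]$ and $\mu+\eta+\nu\le1$. Order on PFNs: for $\alpha=\langle\mu_\alpha,\eta_\alpha,\nu_\alpha\rangle$ put $S(\alpha)=\mu_\alpha-\nu_\alpha$, $H_1(\alpha)=\mu_\alpha+\nu_\alpha$, $H_2(\alpha)=\mu_\alpha+\eta_\alpha+\nu_\alpha$. Then $\alpha\prec_{\mathrm W}\beta$ iff $(S(\alpha),H_1(\alpha),H_2(\alpha))$ is strictly lexicographically smaller than $(S(\beta),H_1(\beta),H_2(\beta))$, and $\alpha\preccurlyeq_{\mathrm W}\beta$ means $\alpha\prec_{\mathrm W}\beta$ or $\alpha=\beta$ (a linear order). A t-norm is a commutative, associative map $T:[0,1]^2\to[0,1]$, nondecreasing in each variable, with $T(1,x)=x$. It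 is strict if it is continuous and $T(x,y)<T(x,z)$ whenever $x>0$ and $y<z$. A strict t-norm has a continuous additive generator: a continuous strictly decreasing bijection $\tau:[0,1]\to[0,+\infty]$ with $\tau(1)=0$, $\tau(0)=+\infty$ and $T(x,y)=\tau^{-1}(\tau(x)+\tau(y))$. Its dual t-conorm is $S(x,y)=1-T(1-x,1-y)=\zeta^{-1}(\zeta(x)+\zeta(y))$, where $\zeta(x)=\tau(1-x)$. Arithmetic in $[0,+\infty]$ is the usual one ($a+\infty=\infty$, $\lambda\cdot\infty=\infty$ for $\lambda>0$). For a strict t-norm $T$, PFNs $\alpha_k=\langle\mu_k,\eta_k,\nu_k\rangle$ ($k=1,2$), $\alpha=\langle\mu,\eta,\nu\rangle$ and $\lambda>0$ define: $\alpha_1\oplus\alpha_2=\langle S(\mu_1,\mu_2),\,T(\eta_1+\nu_1,\eta_2+\nu_2)-T(\nu_1,\nu_2),\,T(\nu_1,\nu_2)\rangle$; $\alpha_1\otimes\alpha_2=\langle T(\mu_1,\mu_2),\,T(\eta_1+\mu_1,\eta_2+\mu_2)-T(\mu_1,\mu_2),\,S(\nu_1,\nu_2)\rangle$; $\lambda\cdot\alpha=\langle\zeta^{-1}(\lambda\zeta(\mu)),\,\tau^{-1}(\lambda\tau(\eta+\nu))-\tau^{-1}(\lambda\tau(\nu)),\,\tau^{-1}(\lambda\tau(\nu))\rangle$; $\alpha^\lambda=\langle\tau^{-1}(\lambda\tau(\mu)),\,\tau^{-1}(\lambda\tau(\eta+\mu))-\tau^{-1}(\lambda\tau(\mu)),\,\zeta^{-1}(\lambda\zeta(\nu))\rangle$.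 These operations send PFNs to PFNs, and $\oplus,\otimes$ are commutative and associative (known facts), so iterated $\bigoplus$ is well defined. For $p,q>0$ the picture fuzzy interactional Bonferroni mean induced by $T$ is $$\mathrm{PFIBM}_T^{p,q}(\alpha_1,\dots,\alpha_n)=\Big[\tfrac1{n(n-1)}\cdot\bigoplus_{i,j=1,\ i\ne j}^n(\alpha_i^p\otimes\alpha_j^q)\Big]^{\frac1{p+q}}.$$ The order $\preccurlyeq_{\mathrm W}$ is applied, via the same functions $S,H_1,H_2$, to the triples bounding the mean in the claim. *)

(* Defs.v *)
From HB Require Import structures.
From mathcomp Require Import all_boot all_order all_algebra.
From mathcomp Require Import all_classical all_reals all_analysis.
Import Order.TTheory GRing.Theory Num.Theory.
Import numFieldNormedType.Exports.

Set Implicit Arguments.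
Unset Strict Implicit.
Unset Printing Implicit Defensive.

Local Open Scope classical_set_scope.
Local Open Scope ring_scope.

(* The operations below are total on triples of reals; they are only meaningful
   on the triples that satisfy [is_pfn]. *)
Record triple (R : realType) : Type :=
  Triple { pf_mu : R ; pf_eta : R ; pf_nu : R }.

Definition is_pfn (R : realType) (a : triple R) : Prop :=
  [/\ 0 <= pf_mu a <= 1, 0 <= pf_eta a <= 1, 0 <= pf_nu a <= 1
    & pf_mu a + pf_eta a + pf_nu a <= 1].

Definition scoreS (R : realType) (a : triple R) : R := pf_mu a - pf_nu a.
Definition accH1 (R : realType) (a : triple R) : R := pf_mu a + pf_nu a.
Definition accH2 (R : realType) (a : triple R) : R := pf_mu a + pf_eta a + pf_nu a.

Definition ltW (R : realType) (a b : triple R) : Prop :=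
  scoreS a < scoreS b \/
  scoreS a = scoreS b /\
    (accH1 a < accH1 b \/ accH1 a = accH1 b /\ accH2 a < accH2 b).

Definition leW (R : realType) (a b : triple R) : Prop := ltW a b \/ a = b.

(* Maps on [0,1] are represented by functions on R of which only the values on
   [0,1] are constrained and used. *)
Definition is_tnorm (R : realType) (T : R -> R -> R) : Prop :=
  (forall x y, x \in `[0, 1] -> y \in `[0, 1] -> T x y \in `[0, 1]) /\
  (forall x y, x \in `[0, 1] -> y \in `[0, 1] -> T x y = T y x) /\
  (forall x y z, x \in `[0, 1] -> y \in `[0, 1] -> z \in `[0, 1] ->
     T (T x y) z = T x (T y z)) /\
  (forall x x' y, x \in `[0, 1] -> x' \in `[0, 1] -> y \in `[0, 1] ->
     x <= x' -> T x y <= T x' y) /\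
  (forall x y y', x \in `[0, 1] -> y \in `[0, 1] -> y' \in `[0, 1] ->
     y <= y' -> T x y <= T x y') /\
  (forall x, x \in `[0, 1] -> T 1 x = x).

Definition is_strict_tnorm (R : realType) (T : R -> R -> R) : Prop :=
  [/\ is_tnorm T,
      {within `[0, 1] `*` `[0, 1], continuous (fun z : R * R => T z.1 z.2)}
    & forall x y z, x \in `[0, 1] -> y \in `[0, 1] -> z \in `[0, 1] ->
        0 < x -> y < z -> T x y < T x z].

Definition inv01 (R : realType) (f : R -> \bar R) : \bar R -> R :=
  'pinv_(fun=> 0) `[0, 1] f.

Definition is_additive_generator (R : realType) (T : R -> R -> R)
    (tau : R -> \bar R) : Prop :=
  {within `[0, 1], continuous tau} /\
  (forall x y, x \in `[0, 1] -> y \in `[0, 1] ->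
     x < y -> (tau y < tau x)%E) /\
  set_bij `[0, 1] [set t | (0 <= t)%E] tau /\
  tau 1 = 0%E /\ tau 0 = +oo%E /\
  (forall x y, x \in `[0, 1] -> y \in `[0, 1] ->
     T x y = inv01 tau (tau x + tau y)%E).

Definition dual_tconorm (R : realType) (T : R -> R -> R) (x y : R) : R :=
  1 - T (1 - x) (1 - y).

Definition dual_generator (R : realType) (tau : R -> \bar R) (x : R) : \bar R :=
  tau (1 - x).

Definition pf_add (R : realType) (T : R -> R -> R) (a b : triple R) :
    triple R :=
  Triple (dual_tconorm T (pf_mu a) (pf_mu b))
         (T (pf_eta a + pf_nu a) (pf_eta b + pf_nu b) - T (pf_nu a) (pf_nu b))
         (T (pf_nu a) (pf_nu b)).

Definition pf_mul (R : realType) (T : R -> R -> R) (a b : triple R) :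
    triple R :=
  Triple (T (pf_mu a) (pf_mu b))
         (T (pf_eta a + pf_mu a) (pf_eta b + pf_mu b) - T (pf_mu a) (pf_mu b))
         (dual_tconorm T (pf_nu a) (pf_nu b)).

(* x |-> f^-1 (l * f x), for a generator f *)
Definition gen_scale (R : realType) (f : R -> \bar R) (l x : R) : R :=
  inv01 f (l%:E * f x)%E.

Definition pf_scale (R : realType) (tau : R -> \bar R) (l : R) (a : triple R) :
    triple R :=
  Triple (gen_scale (dual_generator tau) l (pf_mu a))
         (gen_scale tau l (pf_eta a + pf_nu a) - gen_scale tau l (pf_nu a))
         (gen_scale tau l (pf_nu a)).

Definition pf_pow (R : realType) (tau : R -> \bar R) (a : triple R) (l : R) :
    triple R :=
  Triple (gen_scale tau l (pf_mu a))
         (gen_scale tau l (pf_eta a + pf_mu a) - gen_scale tau l (pf_mu a))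
         (gen_scale (dual_generator tau) l (pf_nu a)).

(* <0,0,1> is a picture fuzzy number and is neutral for [pf_add T] on picture
   fuzzy numbers, so that using it as initial value does not change an
   iterated sum. *)
Definition pf_zero (R : realType) : triple R := Triple 0 0 1.

Definition PFIBM (R : realType) (T : R -> R -> R) (tau : R -> \bar R)
    (p q : R) (n : nat) (alpha : 'I_n -> triple R) : triple R :=
  pf_pow tau
    (pf_scale tau (n%:R * (n%:R - 1))^-1
       (\big[pf_add T / pf_zero R]_(ij : 'I_n * 'I_n | ij.1 != ij.2)
          pf_mul T (pf_pow tau (alpha ij.1) p) (pf_pow tau (alpha ij.2) q)))
    (p + q)^-1.

(* Minimum and maximum of a nonempty finite family of numbers in [0,1]: the
   initial values 1 and 0 are neutral there. *)
Definition min01 (R : realType) (n : nat) (x : 'I_n -> R) : R :=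
  \big[Num.min/1]_(i < n) x i.
Definition max01 (R : realType) (n : nat) (x : 'I_n -> R) : R :=
  \big[Num.max/0]_(i < n) x i.

(* Main.v *)
Require Import Defs.
From HB Require Import structures.
From mathcomp Require Import all_boot all_order all_algebra.
From mathcomp Require Import all_classical all_reals all_analysis.
From mathcomp Require Import lra.
Import Order.TTheory GRing.Theory Num.Theory.
Import numFieldNormedType.Exports.
Local Open Scope classical_set_scope.
Local Open Scope ring_scope.

Set Implicit Arguments.
Unset Strict Implicit.
Unset Printing Implicit Defensive.

(** The membership degree of the mean and one minus its non-membership degree
    are both values of one scalar mean [bonferroni], so both lie between the
    extreme values of the data, which settles the comparison of scores. If the
    scores agree, so do the two degrees.  For the upper bound, the claim is then
    only that the mean is again a picture fuzzy number.  For the lower bound,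
    the equality case of the scalar mean makes the membership and non-membership
    degrees of all the pairs alpha_i^p * alpha_j^q (i <> j) constant, and then
    the neutral degree can be bounded through the sums eta + mu and eta + nu,
    which the operations propagate monotonically. *)

(** * Generators, their inverses and the operations on [0,1] *)

Lemma unitC (R : realType) (x : R) :
  x \in `[0, 1] -> 1 - x \in `[0, 1].
Proof. rewrite !in_itv /=; lra. Qed.

Lemma generator_inj (R : realType) (T : R -> R -> R) (tau : R -> \bar R)
    (htau : is_additive_generator T tau) (x y : R) :
  x \in `[0, 1] -> y \in `[0, 1] -> tau x = tau y -> x = y.
Proof.
move=> xI yI txy; have [_ [tau_lt _]] := htau.
case: (ltgtP x y) => // [/(tau_lt _ _ xI yI)|/(tau_lt _ _ yI xI)];
  by rewrite txy ltxx.
Qed.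

Lemma generator_le (R : realType) (T : R -> R -> R) (tau : R -> \bar R)
    (htau : is_additive_generator T tau) (x y : R) :
  x \in `[0, 1] -> y \in `[0, 1] -> (tau x <= tau y)%E = (y <= x).
Proof.
move=> xI yI; have [_ [tau_lt _]] := htau.
case: (ltgtP y x) => [/(tau_lt _ _ yI xI)/ltW //| xy | ->]; last by rewrite lexx.
by apply/negbTE; rewrite -ltNge; exact: tau_lt.
Qed.

Lemma generator_ge0 (R : realType) (T : R -> R -> R) (tau : R -> \bar R)
    (htau : is_additive_generator T tau) (x : R) :
  x \in `[0, 1] -> (0 <= tau x)%E.
Proof.
move=> xI; have [_ [_ [_ [<- _]]]] := htau.
rewrite (generator_le htau) //; last by rewrite in_itv /=; lra.
by move: xI; rewrite in_itv /= => /andP[].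
Qed.

Lemma inv_generatorK (R : realType) (T : R -> R -> R) (tau : R -> \bar R)
    (htau : is_additive_generator T tau) (x : R) :
  x \in `[0, 1] -> inv01 tau (tau x) = x.
Proof.
move=> xI; apply: pinvKV; last by rewrite inE.
by move=> a b; rewrite !inE => aI bI; exact: (generator_inj htau).
Qed.

Lemma inv_generatorP (R : realType) (T : R -> R -> R) (tau : R -> \bar R)
    (htau : is_additive_generator T tau) (y : \bar R) :
  (0 <= y)%E -> inv01 tau y \in `[0, 1] /\ tau (inv01 tau y) = y.
Proof.
move=> y0; have [_ [_ [[_ _ tau_surj] _]]] := htau.
by have [x xI <-] := tau_surj y y0; rewrite (inv_generatorK htau).
Qed.

(** The dual generator is [tau] after the reflection of [0,1], so inverting it means inverting [tau]
    and reflecting. The value [y] has to lie in the range of [tau]: elsewhere both inverses return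
    the default 0. *)
Lemma inv_dual_generator (R : realType) (T : R -> R -> R) (tau : R -> \bar R)
    (htau : is_additive_generator T tau) (y : \bar R) :
  (0 <= y)%E -> inv01 (dual_generator tau) y = 1 - inv01 tau y.
Proof.
move=> y0; have [xI {1}<-] := inv_generatorP htau y0.
set x := inv01 tau y; have -> : tau x = dual_generator tau (1 - x).
  by rewrite /dual_generator subKr.
apply: pinvKV; last by rewrite inE; exact: unitC.
move=> a b; rewrite !inE => aI bI /(generator_inj htau (unitC aI) (unitC bI)).
by move=> ?; lra.
Qed.

Lemma tnormP (R : realType) (T : R -> R -> R) (tau : R -> \bar R)
    (htau : is_additive_generator T tau) (x y : R) :
  x \in `[0, 1] -> y \in `[0, 1] ->
  T x y \in `[0, 1] /\ tau (T x y) = (tau x + tau y)%E.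
Proof.
move=> xI yI; have [_ [_ [_ [_ [_ ->]]]]] // := htau.
by apply: (inv_generatorP htau); rewrite adde_ge0 ?(generator_ge0 htau).
Qed.

Lemma tnorm_le (R : realType) (T : R -> R -> R) (tau : R -> \bar R)
    (htau : is_additive_generator T tau) (x x' y y' : R) :
  x \in `[0, 1] -> x' \in `[0, 1] -> y \in `[0, 1] -> y' \in `[0, 1] ->
  x <= x' -> y <= y' -> T x y <= T x' y'.
Proof.
move=> xI xI' yI yI' xx yy.
have [TI Tt] := tnormP htau xI yI; have [TI' Tt'] := tnormP htau xI' yI'.
by rewrite -(generator_le htau) // Tt Tt' leeD // (generator_le htau).
Qed.

Lemma gen_scaleP (R : realType) (T : R -> R -> R) (tau : R -> \bar R)
    (htau : is_additive_generator T tau) (l x : R) :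
  0 < l -> x \in `[0, 1] ->
  gen_scale tau l x \in `[0, 1] /\ tau (gen_scale tau l x) = (l%:E * tau x)%E.
Proof.
move=> l0 xI; apply: (inv_generatorP htau).
by rewrite mule_ge0 ?(generator_ge0 htau) // lee_fin ltW.
Qed.

(** Multiplication by a positive real preserves and reflects the order of [0,+oo]. As an equality of
    Booleans, this serves both as monotonicity and as cancellation. *)
Lemma gen_scale_le (R : realType) (T : R -> R -> R) (tau : R -> \bar R)
    (htau : is_additive_generator T tau) (l x y : R) :
  0 < l -> x \in `[0, 1] -> y \in `[0, 1] ->
  (gen_scale tau l x <= gen_scale tau l y) = (x <= y).
Proof.
move=> l0 xI yI; have [gxI gx] := gen_scaleP htau l0 xI.
have [gyI gy] := gen_scaleP htau l0 yI.
by rewrite -(generator_le htau) // gx gy lee_pmul2l // (generator_le htau).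
Qed.

Lemma gen_scaleVK (R : realType) (T : R -> R -> R) (tau : R -> \bar R)
    (htau : is_additive_generator T tau) (l x : R) :
  0 < l -> x \in `[0, 1] -> gen_scale tau l^-1 (gen_scale tau l x) = x.
Proof.
move=> l0 xI; have [_ gx] := gen_scaleP htau l0 xI.
rewrite /gen_scale -/(gen_scale tau l x) gx muleA -EFinM mulVf ?gt_eqF //.
by rewrite mul1e (inv_generatorK htau).
Qed.

(** This eliminates the dual generator: after complementing, degrees combined by the t-conorm are
    combined by [T]. *)
Lemma gen_scale_dual (R : realType) (T : R -> R -> R) (tau : R -> \bar R)
    (htau : is_additive_generator T tau) (l x : R) :
  0 < l -> x \in `[0, 1] ->
  gen_scale (dual_generator tau) l x = 1 - gen_scale tau l (1 - x).
Proof.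
move=> l0 xI; rewrite /gen_scale (inv_dual_generator htau) //.
by rewrite mule_ge0 ?(generator_ge0 htau) ?unitC // lee_fin ltW.
Qed.

(** * Means over ordered pairs of distinct indices *)

Lemma bigtnormP (R : realType) (T : R -> R -> R) (tau : R -> \bar R)
    (htau : is_additive_generator T tau) (I : finType) (P : pred I) (x : I -> R) :
  (forall i, P i -> x i \in `[0, 1]) ->
  \big[T/1]_(i | P i) x i \in `[0, 1] /\
  tau (\big[T/1]_(i | P i) x i) = (\sum_(i | P i) tau (x i))%E.
Proof.
move=> xI; have [_ [_ [_ [tau1 _]]]] := htau.
elim/big_rec2: _ => [|i s y Pi [yI <-]]; first by rewrite in_itv /= ler01 lexx.
exact: (tnormP htau (xI _ Pi) yI).
Qed.

Lemma card_offdiag (n : nat) :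
  #|[pred ij : 'I_n * 'I_n | ij.1 != ij.2]| = (n * n.-1)%N.
Proof.
rewrite -sum1_card.
transitivity (\sum_(i < n) \sum_(j < n | i != j) 1)%N; first by rewrite pair_big_dep.
rewrite (eq_bigr (fun=> n.-1)) ?sum_nat_const ?card_ord // => i _.
rewrite sum1_card -(eq_card (A := predC1 i)) ?cardC1 ?card_ord // => j.
by rewrite !inE eq_sym.
Qed.

(** The quasi-arithmetic mean with generator [tau]: its image under [tau] is the average of the
    [tau (x ij)] over the n(n-1) off-diagonal pairs. *)
Definition offdiag_mean (R : realType) (T : R -> R -> R) (tau : R -> \bar R)
    (n : nat) (x : 'I_n * 'I_n -> R) : R :=
  gen_scale tau (n%:R * (n%:R - 1))^-1 (\big[T/1]_(ij | ij.1 != ij.2) x ij).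

Definition pair_power (R : realType) (T : R -> R -> R) (tau : R -> \bar R)
    (p q x y : R) : R :=
  T (gen_scale tau p x) (gen_scale tau q y).

Lemma natr_pairs_gt0 (R : realType) (n : nat) :
  (2 <= n)%N -> (0 : R) < n%:R * (n%:R - 1).
Proof. by move=> n2; rewrite mulr_gt0 ?subr_gt0 ?ltr1n // ltr0n; apply: ltnW. Qed.

(** The factor n(n-1) is kept on the left, so that means are compared through plain sums in
    [0,+oo]. *)
Lemma offdiag_meanP (R : realType) (T : R -> R -> R) (tau : R -> \bar R)
    (htau : is_additive_generator T tau) (n : nat) (hn : (2 <= n)%N)
    (x : 'I_n * 'I_n -> R) :
  (forall ij, ij.1 != ij.2 -> x ij \in `[0, 1]) ->
  offdiag_mean T tau x \in `[0, 1] /\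
  ((n%:R * (n%:R - 1))%:E * tau (offdiag_mean T tau x) =
     \sum_(ij | ij.1 != ij.2) tau (x ij))%E.
Proof.
move=> xI; have [bI bt] := bigtnormP htau xI.
have k0 := natr_pairs_gt0 R hn.
have k0' : 0 < (n%:R * (n%:R - 1) : R)^-1 by rewrite invr_gt0.
have [mI mt] := gen_scaleP htau k0' bI.
by split=> //; rewrite mt muleA -EFinM mulfV ?gt_eqF // mul1e.
Qed.

Lemma offdiag_mean_le (R : realType) (T : R -> R -> R) (tau : R -> \bar R)
    (htau : is_additive_generator T tau) (n : nat) (hn : (2 <= n)%N)
    (x y : 'I_n * 'I_n -> R) :
  (forall ij, ij.1 != ij.2 -> x ij \in `[0, 1]) ->
  (forall ij, ij.1 != ij.2 -> y ij \in `[0, 1]) ->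
  (forall ij, ij.1 != ij.2 -> x ij <= y ij) ->
  offdiag_mean T tau x <= offdiag_mean T tau y.
Proof.
move=> xI yI xy; have [mxI mx] := offdiag_meanP htau hn xI.
have [myI my] := offdiag_meanP htau hn yI.
rewrite -(generator_le htau) // -(lee_pmul2l (x := (n%:R * (n%:R - 1))%:E)) //.
  by rewrite mx my; apply: lee_sum => ij ne; rewrite (generator_le htau) ?xI ?yI ?xy.
by rewrite lte_fin natr_pairs_gt0.
Qed.

Lemma sum_offdiag_const (R : realType) (n : nat) (r : \bar R) :
  (2 <= n)%N -> (0 <= r)%E ->
  (\sum_(ij : 'I_n * 'I_n | ij.1 != ij.2) r = (n%:R * (n%:R - 1))%:E * r)%E.
Proof.
move=> n2 r0; rewrite big_const card_offdiag.
(* The factor becomes a natural number, the number of pairs, which allows induction on the number of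
   terms. *)
have -> : n%:R * (n%:R - 1) = (n * n.-1)%:R :> R.
  by rewrite natrM -subn1 natrB // ltnW.
elim: (n * n.-1)%N => [|k IH]; first by rewrite mul0e.
by rewrite iterS IH -addn1 natrD EFinD ge0_muleDl ?lee_fin ?ler0n ?ler01 // mul1e addeC.
Qed.

Lemma offdiag_mean_const (R : realType) (T : R -> R -> R) (tau : R -> \bar R)
    (htau : is_additive_generator T tau) (n : nat) (hn : (2 <= n)%N) (c : R) :
  c \in `[0, 1] -> offdiag_mean T tau (fun _ : 'I_n * 'I_n => c) = c.
Proof.
move=> cI.
have [mI mt] := offdiag_meanP htau hn (x := fun=> c) (fun _ _ => cI).
move: mt; rewrite sum_offdiag_const ?(generator_ge0 htau) // => mt.
have k0 : (0 < (n%:R * (n%:R - 1) : R)%:E)%E by rewrite lte_fin natr_pairs_gt0.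
(* The factor n(n-1) is cancelled through two inequalities, which also covers [tau c] infinite. *)
apply: (generator_inj htau) => //; apply: le_anti; apply/andP.
by split; rewrite -(lee_pmul2l (x := (n%:R * (n%:R - 1))%:E)) // mt lexx.
Qed.

(* When [c > 0], [tau c] is finite and the mean is an arithmetic mean of values
   all at least [tau c]; when [c = 0] the hypothesis alone forces [x ij = 0]. *)
Lemma offdiag_mean_max_eq (R : realType) (T : R -> R -> R) (tau : R -> \bar R)
    (htau : is_additive_generator T tau) (n : nat) (hn : (2 <= n)%N)
    (x : 'I_n * 'I_n -> R) (c : R) :
  (forall ij, ij.1 != ij.2 -> x ij \in `[0, 1]) -> c \in `[0, 1] ->
  (forall ij, ij.1 != ij.2 -> x ij <= c) -> offdiag_mean T tau x = c ->
  forall ij, ij.1 != ij.2 -> x ij = c.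
Proof.
move=> xI cI xc mc ij ne; have xcij := xc _ ne; have xIij := xI _ ne.
apply/eqP; rewrite eq_le xcij /= leNgt; apply/negP => lt_xc.
have [_] := offdiag_meanP htau hn xI; rewrite mc => mt.
have [_ [tau_lt [_ [_ [tau0 _]]]]] := htau.
have c0 : 0 < c by move: xIij; rewrite in_itv /=; lra.
have tcfin : tau c \is a fin_num.
  rewrite ge0_fin_numE ?(generator_ge0 htau) // -tau0; apply: tau_lt => //.
  by rewrite in_itv /= lexx ler01.
(* One strictly larger term makes the whole sum larger: the remaining terms are at least [tau c],
   and since [tau c] is finite the strict inequality survives the addition. *)
suff : ((n%:R * (n%:R - 1))%:E * tau c < \sum_(ij | ij.1 != ij.2) tau (x ij))%E.
  by rewrite mt ltxx.
rewrite -sum_offdiag_const ?(generator_ge0 htau) // (bigD1 ij) //= [ltRHS](bigD1 ij) //=.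
rewrite lte_leD ?tau_lt //; first by rewrite sum_fin_num; apply/allP => t /mapP [? ? ->].
by apply: lee_sum => kl /andP[kl_ne _]; rewrite (generator_le htau) ?xI ?xc.
Qed.

(** * Products of two powers and the scalar Bonferroni mean *)

Lemma pair_power_in (R : realType) (T : R -> R -> R) (tau : R -> \bar R)
    (htau : is_additive_generator T tau) (p q x y : R) :
  0 < p -> 0 < q -> x \in `[0, 1] -> y \in `[0, 1] ->
  pair_power T tau p q x y \in `[0, 1].
Proof.
move=> p0 q0 xI yI; have [gxI _] := gen_scaleP htau p0 xI.
have [gyI _] := gen_scaleP htau q0 yI.
by have [] := tnormP htau gxI gyI.
Qed.

Lemma pair_power_le (R : realType) (T : R -> R -> R) (tau : R -> \bar R)
    (htau : is_additive_generator T tau) (p q x x' y y' : R) :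
  0 < p -> 0 < q ->
  x \in `[0, 1] -> x' \in `[0, 1] -> y \in `[0, 1] -> y' \in `[0, 1] ->
  x <= x' -> y <= y' -> pair_power T tau p q x y <= pair_power T tau p q x' y'.
Proof.
move=> p0 q0 xI xI' yI yI' xx yy.
have scI l z : 0 < l -> z \in `[0, 1] -> gen_scale tau l z \in `[0, 1].
  by move=> l0 zI; have [] := gen_scaleP htau l0 zI.
by apply: (tnorm_le htau); rewrite ?scI ?(gen_scale_le htau).
Qed.

(** On the generator side this is distributivity of p + q. It makes the scalar mean idempotent,
    since the outer exponent 1/(p+q) undoes the power p + q. *)
Lemma pair_power_diag (R : realType) (T : R -> R -> R) (tau : R -> \bar R)
    (htau : is_additive_generator T tau) (p q x : R) :
  0 < p -> 0 < q -> x \in `[0, 1] ->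
  pair_power T tau p q x x = gen_scale tau (p + q) x.
Proof.
move=> p0 q0 xI; have [pI pt] := gen_scaleP htau p0 xI.
have [qI qt] := gen_scaleP htau q0 xI.
have [sI st] := gen_scaleP htau (addr_gt0 p0 q0) xI.
have [tI tt] := tnormP htau pI qI.
apply: (generator_inj htau) => //; rewrite tt pt qt st EFinD ge0_muleDl //;
  by rewrite lee_fin ltW.
Qed.

(** Powers and products use [T], while the averaging uses the dual t-conorm, written here as a
    [T]-mean of complements. *)
Definition bonferroni (R : realType) (T : R -> R -> R) (tau : R -> \bar R)
    (p q : R) (n : nat) (x : 'I_n -> R) : R :=
  gen_scale tau (p + q)^-1
    (1 - offdiag_mean T tau
           (fun ij => 1 - pair_power T tau p q (x ij.1) (x ij.2))).

Lemma bonferroni_bounds (R : realType) (T : R -> R -> R) (tau : R -> \bar R)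
    (htau : is_additive_generator T tau) (n : nat) (hn : (2 <= n)%N) (p q : R)
    (hp : 0 < p) (hq : 0 < q) (x : 'I_n -> R) (a b : R) :
  a \in `[0, 1] -> b \in `[0, 1] -> (forall i, x i \in `[0, 1]) ->
  (forall i, a <= x i) -> (forall i, x i <= b) ->
  a <= bonferroni T tau p q x <= b.
Proof.
move=> aI bI xI ax xb; have s0 := addr_gt0 hp hq.
have s0' : 0 < (p + q)^-1 by rewrite invr_gt0.
have scI l z : 0 < l -> z \in `[0, 1] -> gen_scale tau l z \in `[0, 1].
  by move=> l0 zI; have [] := gen_scaleP htau l0 zI.
have ppI ij : ij.1 != ij.2 -> 1 - pair_power T tau p q (x ij.1) (x ij.2) \in `[0, 1].
  by move=> _; rewrite unitC // (pair_power_in htau).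
have [mI _] := offdiag_meanP htau hn ppI.
have bnd c : c \in `[0, 1] ->
    offdiag_mean T tau (fun _ : 'I_n * 'I_n => 1 - gen_scale tau (p + q) c) =
    1 - gen_scale tau (p + q) c.
  by move=> cI; rewrite (offdiag_mean_const htau) // unitC // scI.
(* Each bound is written as the outer root of its own power p + q, so that the root cancels on both
   sides. *)
rewrite -[a](gen_scaleVK htau s0 aI) -[b](gen_scaleVK htau s0 bI).
have gaI := scI _ _ s0 aI; have gbI := scI _ _ s0 bI.
rewrite !(gen_scale_le htau) ?unitC //.
(* Both bounds become means of constant families, which leaves a termwise comparison of
   complements. *)
rewrite lerBrDl -lerBrDr -(bnd a) // lerBlDl -lerBlDr -(bnd b) //.
apply/andP; split; apply: (offdiag_mean_le htau) => // ij ne;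
  rewrite ?unitC // lerB // -(pair_power_diag htau) //;
  exact: (pair_power_le htau).
Qed.

(* Equality does not force the [x i] to coincide: if [c = 0], one of them may be
   positive. Only the off-diagonal powers are determined. *)
Lemma bonferroni_min_eq (R : realType) (T : R -> R -> R) (tau : R -> \bar R)
    (htau : is_additive_generator T tau) (n : nat) (hn : (2 <= n)%N) (p q : R)
    (hp : 0 < p) (hq : 0 < q) (x : 'I_n -> R) (c : R) :
  c \in `[0, 1] -> (forall i, x i \in `[0, 1]) -> (forall i, c <= x i) ->
  bonferroni T tau p q x = c ->
  forall ij : 'I_n * 'I_n, ij.1 != ij.2 ->
    pair_power T tau p q (x ij.1) (x ij.2) = gen_scale tau (p + q) c.
Proof.
move=> cI xI cx bc ij ne; have s0 := addr_gt0 hp hq.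
have s0' : 0 < (p + q)^-1 by rewrite invr_gt0.
have [gI _] := gen_scaleP htau s0 cI.
pose y (ij : 'I_n * 'I_n) := 1 - pair_power T tau p q (x ij.1) (x ij.2).
have yI kl : kl.1 != kl.2 -> y kl \in `[0, 1].
  by move=> _; rewrite unitC // (pair_power_in htau).
have [mI _] := offdiag_meanP htau hn yI.
(* The outer root is injective, so equality already holds for the inner mean. *)
have mE : offdiag_mean T tau y = 1 - gen_scale tau (p + q) c.
  move: bc; rewrite /bonferroni -/y -{1}(gen_scaleVK htau s0 cI) => bc.
  suff : 1 - offdiag_mean T tau y = gen_scale tau (p + q) c by move=> ?; lra.
  apply: le_anti; apply/andP.
  by split; rewrite -(gen_scale_le htau s0') ?unitC // bc lexx.
suff yE : y ij = 1 - gen_scale tau (p + q) c.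
  by rewrite -[LHS](subKr 1) -[1 - pair_power _ _ _ _ _ _]/(y ij) yE subKr.
apply: (offdiag_mean_max_eq htau hn yI (unitC gI)) => // kl _.
by rewrite lerB // -(pair_power_diag htau) //; exact: (pair_power_le htau).
Qed.

(** * Averages of picture fuzzy triples over pairs *)

Definition pf_mean (R : realType) (T : R -> R -> R) (tau : R -> \bar R)
    (n : nat) (Y : 'I_n * 'I_n -> triple R) : triple R :=
  pf_scale tau (n%:R * (n%:R - 1))^-1
    (\big[pf_add T / pf_zero R]_(ij | ij.1 != ij.2) Y ij).

(** Complementing the membership degree turns [pf_add T] into [T] and [pf_zero] into 1, hence the
    iterated sum into an iterated t-norm. *)
Lemma pf_mean_mu (R : realType) (T : R -> R -> R) (tau : R -> \bar R)
    (htau : is_additive_generator T tau) (n : nat) (hn : (2 <= n)%N)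
    (Y : 'I_n * 'I_n -> triple R) :
  (forall ij, ij.1 != ij.2 -> pf_mu (Y ij) \in `[0, 1]) ->
  pf_mu (pf_mean T tau Y) = 1 - offdiag_mean T tau (fun ij => 1 - pf_mu (Y ij)).
Proof.
move=> muI; rewrite /pf_mean /offdiag_mean.
have bE : 1 - pf_mu (\big[pf_add T / pf_zero R]_(ij | ij.1 != ij.2) Y ij) =
    \big[T/1]_(ij | ij.1 != ij.2) (1 - pf_mu (Y ij)).
  apply: (big_morph (fun a => 1 - pf_mu a)) => [a b|] /=; last by rewrite subr0.
  by rewrite subKr.
have [bI _] := bigtnormP htau (fun ij ne => unitC (muI ij ne)).
rewrite /= (gen_scale_dual htau) ?bE //; first by rewrite invr_gt0 natr_pairs_gt0.
by rewrite -(subKr 1 (pf_mu _)) bE unitC.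
Qed.

Lemma pf_mean_nu (R : realType) (T : R -> R -> R) (tau : R -> \bar R)
    (n : nat) (Y : 'I_n * 'I_n -> triple R) :
  pf_nu (pf_mean T tau Y) = offdiag_mean T tau (fun ij => pf_nu (Y ij)).
Proof.
by rewrite /= (big_morph (@pf_nu R) (id1 := 1) (op1 := T)).
Qed.

(** The neutral degree alone is a difference; adding the non-membership degree cancels the
    subtracted term, and the sum is carried by [T] alone. *)
Lemma pf_mean_eta_nu (R : realType) (T : R -> R -> R) (tau : R -> \bar R)
    (n : nat) (Y : 'I_n * 'I_n -> triple R) :
  pf_eta (pf_mean T tau Y) + pf_nu (pf_mean T tau Y) =
  offdiag_mean T tau (fun ij => pf_eta (Y ij) + pf_nu (Y ij)).
Proof.
rewrite /= subrK /offdiag_mean; congr (gen_scale _ _ _).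
apply: (big_morph (fun a => pf_eta a + pf_nu a)) => [a b|] /=; last by rewrite add0r.
by rewrite subrK.
Qed.

(** * Products of powers of two picture fuzzy numbers *)

Definition pf_pair (R : realType) (T : R -> R -> R) (tau : R -> \bar R)
    (p q : R) (n : nat) (alpha : 'I_n -> triple R) (ij : 'I_n * 'I_n) : triple R :=
  pf_mul T (pf_pow tau (alpha ij.1) p) (pf_pow tau (alpha ij.2) q).

Lemma PFIBM_pf_mean (R : realType) (T : R -> R -> R) (tau : R -> \bar R)
    (p q : R) (n : nat) (alpha : 'I_n -> triple R) :
  PFIBM T tau p q alpha =
  pf_pow tau (pf_mean T tau (pf_pair T tau p q alpha)) (p + q)^-1.
Proof. by []. Qed.

Lemma pf_pair_nu (R : realType) (T : R -> R -> R) (tau : R -> \bar R)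
    (htau : is_additive_generator T tau) (n : nat) (p q : R)
    (hp : 0 < p) (hq : 0 < q) (alpha : 'I_n -> triple R) (ij : 'I_n * 'I_n) :
  (forall i, pf_nu (alpha i) \in `[0, 1]) ->
  pf_nu (pf_pair T tau p q alpha ij) =
  1 - pair_power T tau p q (1 - pf_nu (alpha ij.1)) (1 - pf_nu (alpha ij.2)).
Proof.
by move=> nuI; rewrite /= /dual_tconorm !(gen_scale_dual htau) ?subKr.
Qed.

Lemma pf_pair_eta_mu (R : realType) (T : R -> R -> R) (tau : R -> \bar R)
    (p q : R) (n : nat) (alpha : 'I_n -> triple R) (ij : 'I_n * 'I_n) :
  pf_eta (pf_pair T tau p q alpha ij) + pf_mu (pf_pair T tau p q alpha ij) =
  pair_power T tau p q (pf_eta (alpha ij.1) + pf_mu (alpha ij.1))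
                       (pf_eta (alpha ij.2) + pf_mu (alpha ij.2)).
Proof. by rewrite /= !subrK. Qed.

Lemma is_pfn_unit (R : realType) (a : triple R) : is_pfn a ->
  [/\ pf_mu a \in `[0, 1], pf_nu a \in `[0, 1],
      pf_eta a + pf_mu a \in `[0, 1] & pf_eta a + pf_nu a \in `[0, 1]].
Proof.
move=> [/andP[? ?] /andP[? ?] /andP[? ?] ?].
by rewrite !in_itv /=; split; lra.
Qed.

(** Being a picture fuzzy number amounts to the chain 0 <= mu <= eta + mu <= 1 - nu <= 1. All three
    middle terms are transformed by the same monotone [pair_power], which preserves the chain. *)
Lemma pf_pair_pfn (R : realType) (T : R -> R -> R) (tau : R -> \bar R)
    (htau : is_additive_generator T tau) (n : nat) (p q : R)
    (hp : 0 < p) (hq : 0 < q) (alpha : 'I_n -> triple R) (ij : 'I_n * 'I_n) :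
  (forall i, is_pfn (alpha i)) -> is_pfn (pf_pair T tau p q alpha ij).
Proof.
move=> ha.
have muI i : pf_mu (alpha i) \in `[0, 1] by have [] := is_pfn_unit (ha i).
have nuI i : pf_nu (alpha i) \in `[0, 1] by have [] := is_pfn_unit (ha i).
have emI i : pf_eta (alpha i) + pf_mu (alpha i) \in `[0, 1].
  by have [] := is_pfn_unit (ha i).
have le1 i : pf_mu (alpha i) <= pf_eta (alpha i) + pf_mu (alpha i).
  by have [_ /andP[? _] _ _] := ha i; lra.
have le2 i : pf_eta (alpha i) + pf_mu (alpha i) <= 1 - pf_nu (alpha i).
  by have [_ _ _ ?] := ha i; lra.
have em := pf_pair_eta_mu T tau p q alpha ij.
have nu : pair_power T tau p q (1 - pf_nu (alpha ij.1)) (1 - pf_nu (alpha ij.2)) =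
    1 - pf_nu (pf_pair T tau p q alpha ij).
  by rewrite (pf_pair_nu htau hp hq ij nuI) subKr.
have muE : pf_mu (pf_pair T tau p q alpha ij) =
  pair_power T tau p q (pf_mu (alpha ij.1)) (pf_mu (alpha ij.2)) by [].
have := pair_power_in htau hp hq (muI ij.1) (muI ij.2).
have := pair_power_in htau hp hq (unitC (nuI ij.1)) (unitC (nuI ij.2)).
have := pair_power_le htau hp hq (muI ij.1) (emI ij.1) (muI ij.2) (emI ij.2)
  (le1 _) (le1 _).
have := pair_power_le htau hp hq (emI ij.1) (unitC (nuI ij.1)) (emI ij.2)
  (unitC (nuI ij.2)) (le2 _) (le2 _).
rewrite -em nu -muE /is_pfn; case: (pf_pair T tau p q alpha ij) => x y z /=.
rewrite !in_itv /= => ? ? /andP[? ?] /andP[? ?].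
by split; try (apply/andP; split); lra.
Qed.

(** The mirrored chain nu <= eta + nu <= 1 - mu is preserved, because all three terms are averaged
    by the monotone [offdiag_mean]. *)
Lemma pf_mean_pfn (R : realType) (T : R -> R -> R) (tau : R -> \bar R)
    (htau : is_additive_generator T tau) (n : nat) (hn : (2 <= n)%N)
    (Y : 'I_n * 'I_n -> triple R) :
  (forall ij, is_pfn (Y ij)) -> is_pfn (pf_mean T tau Y).
Proof.
move=> hY.
have muI ij : ij.1 != ij.2 -> pf_mu (Y ij) \in `[0, 1].
  by move=> _; have [] := is_pfn_unit (hY ij).
have nuI ij : ij.1 != ij.2 -> pf_nu (Y ij) \in `[0, 1].
  by move=> _; have [] := is_pfn_unit (hY ij).
have enI ij : ij.1 != ij.2 -> pf_eta (Y ij) + pf_nu (Y ij) \in `[0, 1].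
  by move=> _; have [] := is_pfn_unit (hY ij).
have cmuI ij : ij.1 != ij.2 -> 1 - pf_mu (Y ij) \in `[0, 1].
  by move=> /muI /unitC.
have mu := pf_mean_mu htau hn muI.
have nu := pf_mean_nu T tau Y.
have en := pf_mean_eta_nu T tau Y.
have [mI _] := offdiag_meanP htau hn cmuI.
have [nI _] := offdiag_meanP htau hn nuI.
have le1 : offdiag_mean T tau (fun ij => pf_nu (Y ij)) <=
           offdiag_mean T tau (fun ij => pf_eta (Y ij) + pf_nu (Y ij)).
  apply: (offdiag_mean_le htau) => // ij _.
  by have [_ /andP[? _] _ _] := hY ij; lra.
have le2 : offdiag_mean T tau (fun ij => pf_eta (Y ij) + pf_nu (Y ij)) <=
           offdiag_mean T tau (fun ij => 1 - pf_mu (Y ij)).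
  apply: (offdiag_mean_le htau) => // ij _.
  by have [_ _ _ ?] := hY ij; lra.
have mE : offdiag_mean T tau (fun ij => 1 - pf_mu (Y ij)) =
    1 - pf_mu (pf_mean T tau Y) by rewrite mu subKr.
move: mI nI le1 le2; rewrite mE -en -nu /is_pfn.
case: (pf_mean T tau Y) => x y z /=.
rewrite !in_itv /= => /andP[? ?] /andP[? ?] ? ?.
by split; try (apply/andP; split); lra.
Qed.

(** * The outer power and the degrees of the mean *)

Lemma pf_pow_eta_mu (R : realType) (tau : R -> \bar R) (a : triple R) (l : R) :
  pf_eta (pf_pow tau a l) + pf_mu (pf_pow tau a l) =
  gen_scale tau l (pf_eta a + pf_mu a).
Proof. by rewrite /= subrK. Qed.

Lemma pf_pow_nu (R : realType) (T : R -> R -> R) (tau : R -> \bar R)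
    (htau : is_additive_generator T tau) (l : R) (a : triple R) :
  0 < l -> pf_nu a \in `[0, 1] ->
  pf_nu (pf_pow tau a l) = 1 - gen_scale tau l (1 - pf_nu a).
Proof. exact: (gen_scale_dual htau). Qed.

Lemma pf_pow_accH2_le1 (R : realType) (T : R -> R -> R) (tau : R -> \bar R)
    (htau : is_additive_generator T tau) (l : R) (a : triple R) :
  0 < l -> is_pfn a -> accH2 (pf_pow tau a l) <= 1.
Proof.
move=> l0 ha; have [_ nuI emI _] := is_pfn_unit ha.
have := gen_scale_le htau l0 emI (unitC nuI).
have -> : pf_eta a + pf_mu a <= 1 - pf_nu a by have [_ _ _ ?] := ha; lra.
rewrite -pf_pow_eta_mu -[gen_scale _ _ (1 - _)](subKr 1) -(pf_pow_nu htau) //.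
rewrite /accH2; move: (pf_mu _) (pf_eta _) (pf_nu _) => x y z; lra.
Qed.

Lemma PFIBM_mu (R : realType) (T : R -> R -> R) (tau : R -> \bar R)
    (htau : is_additive_generator T tau) (n : nat) (hn : (2 <= n)%N) (p q : R)
    (hp : 0 < p) (hq : 0 < q) (alpha : 'I_n -> triple R) :
  (forall i, is_pfn (alpha i)) ->
  pf_mu (PFIBM T tau p q alpha) = bonferroni T tau p q (fun i => pf_mu (alpha i)).
Proof.
move=> ha; rewrite PFIBM_pf_mean /bonferroni.
transitivity (gen_scale tau (p + q)^-1 (pf_mu (pf_mean T tau (pf_pair T tau p q alpha)))).
  by [].
rewrite (pf_mean_mu htau hn) // => ij _.
by have [] := is_pfn_unit (pf_pair_pfn htau hp hq ij ha).
Qed.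

Lemma PFIBM_nu (R : realType) (T : R -> R -> R) (tau : R -> \bar R)
    (htau : is_additive_generator T tau) (n : nat) (hn : (2 <= n)%N) (p q : R)
    (hp : 0 < p) (hq : 0 < q) (alpha : 'I_n -> triple R) :
  (forall i, is_pfn (alpha i)) ->
  pf_nu (PFIBM T tau p q alpha) =
    1 - bonferroni T tau p q (fun i => 1 - pf_nu (alpha i)).
Proof.
move=> ha; rewrite PFIBM_pf_mean /bonferroni.
have hY ij := pf_pair_pfn htau hp hq ij ha.
have [_ nuI _ _] := is_pfn_unit (pf_mean_pfn htau hn hY).
rewrite (pf_pow_nu htau) //; last by rewrite invr_gt0 addr_gt0.
rewrite pf_mean_nu; congr (1 - gen_scale _ _ (1 - gen_scale _ _ _)).
apply: eq_bigr => ij _; apply: (pf_pair_nu htau) => // i.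
by have [] := is_pfn_unit (ha i).
Qed.

(** * The neutral degree when the scores agree *)

Lemma pf_mean_eta_ge (R : realType) (T : R -> R -> R) (tau : R -> \bar R)
    (htau : is_additive_generator T tau) (n : nat) (hn : (2 <= n)%N)
    (Y : 'I_n * 'I_n -> triple R) (a c e : R) :
  (forall ij, is_pfn (Y ij)) ->
  (forall ij, ij.1 != ij.2 -> pf_mu (Y ij) = a) ->
  (forall ij, ij.1 != ij.2 -> pf_nu (Y ij) = c) ->
  (forall ij, ij.1 != ij.2 -> e <= pf_eta (Y ij)) ->
  0 <= e -> e <= pf_eta (pf_mean T tau Y).
Proof.
move=> hY muE nuE eE e0.
have enI ij : ij.1 != ij.2 -> pf_eta (Y ij) + pf_nu (Y ij) \in `[0, 1].
  by move=> _; have [] := is_pfn_unit (hY ij).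
(* Since [n] is at least 2, an off-diagonal pair exists; it places [c] and [e + c] in [0,1]. *)
have [ij0 ne0] : exists ij : 'I_n * 'I_n, ij.1 != ij.2.
  case: n hn Y {hY muE nuE eE enI} => [|[|n]] // _ _.
  by exists (ord0, ord_max).
have ecI : e + c \in `[0, 1].
  rewrite -(nuE _ ne0); have := enI _ ne0; have := eE _ ne0.
  have [_ _ /andP[? ?] _] := hY ij0; rewrite !in_itv /=; lra.
have cI : c \in `[0, 1].
  by rewrite -(nuE _ ne0); have [] := is_pfn_unit (hY ij0).
have nI ij : ij.1 != ij.2 -> pf_nu (Y ij) \in `[0, 1] by move=> /nuE ->.
(* The mean of eta + nu is at least [e + c] and that of nu at most [c]; their difference is the
   neutral degree of the average. *)
have le_en : e + c <= offdiag_mean T tau (fun ij => pf_eta (Y ij) + pf_nu (Y ij)).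
  rewrite -(offdiag_mean_const htau hn ecI).
  by apply: (offdiag_mean_le htau) => // ij ne; rewrite (nuE _ ne) lerD2r eE.
have le_n : offdiag_mean T tau (fun ij => pf_nu (Y ij)) <= c.
  rewrite -[leRHS](offdiag_mean_const htau hn cI).
  by apply: (offdiag_mean_le htau) => // ij ne; rewrite (nuE _ ne).
move: le_en le_n; rewrite -pf_mean_eta_nu -pf_mean_nu.
move: (pf_eta _) (pf_nu _) => y z; lra.
Qed.

(** Products and powers propagate eta + mu, whereas the averaging propagates eta + nu. Passing from
    one sum to the other needs mu and nu constant over the pairs, which the equality case of the
    scalar mean provides. *)
Lemma PFIBM_eta_ge (R : realType) (T : R -> R -> R) (tau : R -> \bar R)
    (htau : is_additive_generator T tau) (n : nat) (hn : (2 <= n)%N) (p q : R)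
    (hp : 0 < p) (hq : 0 < q) (alpha : 'I_n -> triple R) (m e v : R) :
  (forall i, is_pfn (alpha i)) ->
  m \in `[0, 1] -> v \in `[0, 1] -> 0 <= e ->
  (forall i, m <= pf_mu (alpha i)) -> (forall i, e <= pf_eta (alpha i)) ->
  (forall i, pf_nu (alpha i) <= v) ->
  pf_mu (PFIBM T tau p q alpha) = m -> pf_nu (PFIBM T tau p q alpha) = v ->
  e <= pf_eta (PFIBM T tau p q alpha).
Proof.
move=> ha mI vI e0 mE eE vE muE nuE; have s0 := addr_gt0 hp hq.
have s0' : 0 < (p + q)^-1 by rewrite invr_gt0.
have unit_alpha i := is_pfn_unit (ha i).
have muI i : pf_mu (alpha i) \in `[0, 1] by have [] := unit_alpha i.
have nuI i : pf_nu (alpha i) \in `[0, 1] by have [] := unit_alpha i.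
have emI i : pf_eta (alpha i) + pf_mu (alpha i) \in `[0, 1] by have [] := unit_alpha i.
have hY ij := pf_pair_pfn htau hp hq ij ha.
have cnuE : bonferroni T tau p q (fun i => 1 - pf_nu (alpha i)) = 1 - v.
  by move: nuE; rewrite (PFIBM_nu htau hn hp hq ha); lra.
have YmuE ij : ij.1 != ij.2 ->
    pf_mu (pf_pair T tau p q alpha ij) = gen_scale tau (p + q) m.
  apply: (bonferroni_min_eq htau hn hp hq mI muI mE).
  by rewrite -(PFIBM_mu htau hn hp hq ha).
have YnuE ij : ij.1 != ij.2 ->
    pf_nu (pf_pair T tau p q alpha ij) = 1 - gen_scale tau (p + q) (1 - v).
  move=> ne; rewrite (pf_pair_nu htau hp hq) //; congr (1 - _).
  apply: (bonferroni_min_eq htau hn hp hq (unitC vI) _ _ cnuE ne) => i.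
    exact: unitC.
  by rewrite lerB.
have i0 : 'I_n by apply: (Ordinal (n := n) (m := 0)); apply: ltnW.
have emI' : e + m \in `[0, 1].
  have := emI i0; have := mE i0; have := eE i0.
  by move: mI; rewrite !in_itv /=; lra.
have [gmI _] := gen_scaleP htau s0 mI.
have [geI _] := gen_scaleP htau s0 emI'.
(* For a pair, eta + mu is at least the power p + q of [e + m], and mu is exactly that of [m]; so
   the difference bounds eta from below, and averaging keeps this bound. *)
have Xeta : gen_scale tau (p + q) (e + m) - gen_scale tau (p + q) m <=
    pf_eta (pf_mean T tau (pf_pair T tau p q alpha)).
  apply: (pf_mean_eta_ge htau hn hY YmuE YnuE) => [ij ne|].
    rewrite lerBlDr -(YmuE _ ne) pf_pair_eta_mu -(pair_power_diag htau hp hq) //.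
    by apply: (pair_power_le htau) => //; rewrite lerD.
  by rewrite subr_ge0 (gen_scale_le htau) // lerDr.
set X := pf_mean _ _ _ in Xeta.
have [XmuI XnuI XemI _] := is_pfn_unit (pf_mean_pfn htau hn hY : is_pfn X).
have Xmu : pf_mu X = gen_scale tau (p + q) m.
  have g_mu : gen_scale tau (p + q)^-1 (pf_mu X) = m by [].
  apply: le_anti; apply/andP.
  by split; rewrite -(gen_scale_le htau s0') // g_mu (gen_scaleVK htau).
(* Adding the known membership degree of [X] turns the bound into one on eta + mu, from which the
   outer root recovers [e + m]; subtracting [m] then gives the claim. *)
have : e + m <= gen_scale tau (p + q)^-1 (pf_eta X + pf_mu X).
  rewrite -{1}(gen_scaleVK htau s0 emI') (gen_scale_le htau) //.
  by rewrite Xmu -lerBlDr.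
by rewrite -pf_pow_eta_mu -PFIBM_pf_mean muE lerD2r.
Qed.

(** * Extreme values and the lexicographic comparison *)

Lemma min01P (R : realType) (n : nat) (x : 'I_n -> R) :
  (forall i, x i \in `[0, 1]) ->
  min01 x \in `[0, 1] /\ (forall i, min01 x <= x i).
Proof.
move=> xI; split=> [|i]; last exact: bigmin_le.
rewrite in_itv /= bigmin_le_id andbT; apply: le_bigmin => // i _.
by have := xI i; rewrite in_itv => /andP[].
Qed.

Lemma max01P (R : realType) (n : nat) (x : 'I_n -> R) :
  (forall i, x i \in `[0, 1]) ->
  max01 x \in `[0, 1] /\ (forall i, x i <= max01 x).
Proof.
move=> xI; split=> [|i]; last exact: le_bigmax.
rewrite in_itv /= bigmax_ge_id /=; apply: bigmax_le => // i _.
by have := xI i; rewrite in_itv => /andP[].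
Qed.

Unset Implicit Arguments.

Theorem mainTheorem4 (R : realType) (n : nat) (hn : (2 <= n)%N)
    (T : R -> R -> R) (hT : is_strict_tnorm T)
    (tau : R -> \bar R) (htau : is_additive_generator T tau)
    (p q : R) (hp : 0 < p) (hq : 0 < q)
    (alpha : 'I_n -> triple R) (halpha : forall i, is_pfn (alpha i)) :
  leW (Triple (min01 (fun i => pf_mu (alpha i)))
              (min01 (fun i => pf_eta (alpha i)))
              (max01 (fun i => pf_nu (alpha i))))
      (PFIBM T tau p q alpha) /\
  leW (PFIBM T tau p q alpha)
      (Triple (max01 (fun i => pf_mu (alpha i)))
              (1 - (max01 (fun i => pf_mu (alpha i)) +
                    min01 (fun i => pf_nu (alpha i))))
              (min01 (fun i => pf_nu (alpha i)))).
Proof.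
have unit_alpha i := is_pfn_unit (halpha i).
have muI i : pf_mu (alpha i) \in `[0, 1] by have [] := unit_alpha i.
have nuI i : pf_nu (alpha i) \in `[0, 1] by have [] := unit_alpha i.
have etaI i : pf_eta (alpha i) \in `[0, 1] by have [] := halpha i; rewrite in_itv.
have [minmuI minmu] := min01P muI; have [maxmuI maxmu] := max01P muI.
have [minnuI minnu] := min01P nuI; have [maxnuI maxnu] := max01P nuI.
have [mineI mine] := min01P etaI.
have cnuI i : 1 - pf_nu (alpha i) \in `[0, 1] by exact: unitC.
have /andP[mu_lo mu_hi] := bonferroni_bounds htau hn hp hq minmuI maxmuI muI minmu maxmu.
have /andP[nu_lo nu_hi] := bonferroni_bounds htau hn hp hq (unitC maxnuI)
  (unitC minnuI) cnuI (fun i => lerB (lexx 1) (maxnu i))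
  (fun i => lerB (lexx 1) (minnu i)).
have muE := PFIBM_mu htau hn hp hq halpha.
have nuE := PFIBM_nu htau hn hp hq halpha.
rewrite -muE in mu_lo mu_hi.
have {}nu_lo : pf_nu (PFIBM T tau p q alpha) <= max01 (fun i => pf_nu (alpha i)).
  by rewrite nuE lerBlDl -lerBlDr.
have {}nu_hi : min01 (fun i => pf_nu (alpha i)) <= pf_nu (PFIBM T tau p q alpha).
  by rewrite nuE lerBrDl -lerBrDr.
have mine0 : 0 <= min01 (fun i => pf_eta (alpha i)).
  by move: mineI; rewrite in_itv => /andP[].
have eta_lo := PFIBM_eta_ge htau hn hp hq halpha minmuI maxnuI mine0 minmu mine maxnu.
have H2 : accH2 (PFIBM T tau p q alpha) <= 1.
  apply: (pf_pow_accH2_le1 htau); first by rewrite invr_gt0 addr_gt0.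
  by apply: (pf_mean_pfn htau hn) => ij; exact: (pf_pair_pfn htau hp hq).
(* Only linear arithmetic remains, so the degrees of the mean and the extreme values become plain
   variables. The bound [eta_lo] stays conditional on equality of both degrees. *)
move: mu_lo mu_hi nu_lo nu_hi eta_lo H2; rewrite /leW /ltW /scoreS /accH1 /accH2.
case: (PFIBM T tau p q alpha) => M E N /=.
move: (min01 (fun i => pf_mu _)) (max01 (fun i => pf_mu _)) => m m'.
move: (min01 (fun i => pf_nu _)) (max01 (fun i => pf_nu _)) => v' v.
move: (min01 _) => e mM Mm' Nv v'N eta_lo H2; split.
(* Since m <= M and N <= v, equal scores force M = m and N = v; then [eta_lo] decides through the
   third component. *)
- case: (ltgtP (m - v) (M - N)) => [? | ? | S_eq]; [by left; left | by exfalso; lra |].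
  have Mm : M = m by lra.
  have Nv_eq : N = v by lra.
  have eE := eta_lo Mm Nv_eq; subst M N.
  move: eE; rewrite le_eqVlt => /orP[/eqP <- | eE]; first by right.
  by left; right; split=> //; right; split=> //; rewrite /accH2 /=; lra.
(* Here equal scores again fix both degrees, and the bounding triple has total 1, which the total of
   the mean does not exceed. *)
- case: (ltgtP (M - N) (m' - v')) => [? | ? | S_eq]; [by left; left | by exfalso; lra |].
  have Mm : M = m' by lra.
  have Nv_eq : N = v' by lra.
  subst M N; move: H2; rewrite le_eqVlt => /orP[/eqP H2 | H2].
    by right; congr Triple; lra.
  by left; right; split=> //; right; split=> //; rewrite /accH2 /=; lra.
Qed.
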